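(* Let $H$ be a real separable Hilbert space, $d\in\mathbb N$, $d\ge 1$, $\dim H\ge d$, and fix $\gamma>0$. Let $\mu$ be a Borel probability measure on $H$ with bounded support satisfying either one of the following conditions: (i) $\mu$ is $\gamma$-upper-regular and $\gamma>2$; or (ii) $d=1$ and $\mu$ is $\gamma$-regular with $\gamma>1$. Then $$\int_{H^{d+2}} c_{\mathrm{pol}}^2(X)\,d\mu^{d+2}(X)\le K\cdot e_2^2(\mu,d),$$ where the constant $K>0$ depends (for the fixed exponent $\gamma$) only on $d$, $\operatorname{diam}(\mu)$ and the regularity constant of $\mu$.
   Context: $\mathrm{AG}_d(H)$ is the set of $d$-dimensional affine subspaces of $H$, and $e_2(\mu,d)=\inf_{L\in\mathrm{AG}_d(H)}\sqrt{\int\operatorname{dist}^2(x,L)\,d\mu(x)}$. $\operatorname{diam}(\mu)$ is the diameter of $\operatorname{supp}(\mu)$ and $B(x,t)$ is the closed ball of radius $t$ centered at $x$. For $\gamma>0$, $\mu$ is $\gamma$-regular if there is $C\ge1$ with $t^\gamma/C\le\mu(B(x,t))\le C t^\gamma$ for all $x\in\operatorname{supp}(\mu)$ and $0<t\le\operatorname{diam}(\mu)$; it is $\gamma$-upper-regular if the upper bound holds. The regularity constant of $\mu$ is the minimal such $C\ge 1$ (for both inequalities, or for only the upper one in the upper-regular case). For $X=(x_0,\dots,x_{d+1})\in H^{d+2}$: $\mathrm M_{d+1}(X)$ is the $(d+1)$-volume of any of the parallelotopes generated by the vertices of $X$ (the square root of the Gram determinant of $x_1-x_0,\dots,x_{d+1}-x_0$);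 $\min(X)$ is the minimal and $\operatorname{diam}(X)$ the maximal edge length $\|x_i-x_j\|$, $i\neq j$. The polar sine at $x_i$ is $$p_d\mathrm{sin}_{x_i}(X)=\frac{\mathrm M_{d+1}(X)}{\prod_{0\le j\le d+1,\,j\ne i}\|x_j-x_i\|}\ \text{ if }\min(X)>0,\qquad p_d\mathrm{sin}_{x_i}(X)=0\ \text{ otherwise},$$ and $$c_{\mathrm{pol}}(X)=\operatorname{diam}(X)\sqrt{\frac{\sum_{i=0}^{d+1}\left(p_d\mathrm{sin}_{x_i}(X)\right)^2}{d+2}}.$$ *)

(* Defs.v *)
From HB Require Import structures.
From mathcomp Require Import all_boot all_order all_algebra sesquilinear.
From mathcomp Require Import all_classical all_reals all_analysis.

Set Implicit Arguments.
Unset Strict Implicit.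
Unset Printing Implicit Defensive.

Import Order.TTheory GRing.Theory Num.Theory.
Import numFieldNormedType.Exports.

Local Open Scope classical_set_scope.
Local Open Scope ring_scope.

(* The Borel sigma-algebra of T.  The measurable structure on n.-tuple (borel H)
   is MathComp-Analysis's product one; it is the Borel sigma-algebra of H^n when
   H is separable. *)
Notation borel T := (g_sigma_algebraType (@open T)).

Definition separable (T : topologicalType) : Prop :=
  exists2 S : set T, countable S & dense S.

Section LinearGeometry.
Context {R : realType} {H : normedModType R}.

Definition lin_indep (n : nat) (v : 'I_n -> H) : Prop :=
  forall a : 'I_n -> R, \sum_(i < n) a i *: v i = 0 -> forall i, a i = 0.

(* dim H >= n, the dimension of H being possibly infinite *)
Definition dim_ge (n : nat) : Prop := exists v : 'I_n -> H, lin_indep v.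

Definition AG (d : nat) : set (set H) :=
  [set L | exists (p : H) (v : 'I_d -> H), lin_indep v /\
     L = [set x | exists a : 'I_d -> R, x = p + \sum_(i < d) a i *: v i]].

Definition dist (x : H) (L : set H) : R := inf [set `|x - y| | y in L].

Definition set_diam (A : set H) : R := sup [set `|x - y| | x in A & y in A].

End LinearGeometry.
Arguments dim_ge {R} H n.
Arguments AG {R} H d.

Section BorelMeasures.
Context {R : realType} {H : normedModType R}.
Implicit Types (mu : probability (borel H) R) (gamma C : R) (d : nat).

Definition msupp mu : set H :=
  [set x | forall U : set H, open_nbhs x U -> (0 < mu U)%E].

Definition mdiam mu : R := set_diam (msupp mu).

Definition upper_growth mu gamma C : Prop :=
  forall (x : H) (t : R), msupp mu x -> 0 < t <= mdiam mu ->
    (mu (closed_ball_ Num.norm x t) <= (C * t `^ gamma)%:E)%E.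

Definition lower_growth mu gamma C : Prop :=
  forall (x : H) (t : R), msupp mu x -> 0 < t <= mdiam mu ->
    ((t `^ gamma / C)%:E <= mu (closed_ball_ Num.norm x t))%E.

Definition upper_reg_consts mu gamma : set R :=
  [set C | 1 <= C /\ upper_growth mu gamma C].

Definition reg_consts mu gamma : set R :=
  [set C | [/\ 1 <= C, lower_growth mu gamma C & upper_growth mu gamma C]].

Definition upper_regular mu gamma : Prop := upper_reg_consts mu gamma !=set0.

Definition regular mu gamma : Prop := reg_consts mu gamma !=set0.

(* Both sets of constants are closed and bounded below, so when nonempty their
   infimum is attained. *)
Definition upper_reg_const mu gamma : R := inf (upper_reg_consts mu gamma).

Definition reg_const mu gamma : R := inf (reg_consts mu gamma).

(* The integrals are finite when mu has bounded support. *)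
Definition e2 mu d : \bar R :=
  ereal_inf [set sqrte (\int[mu]_x ((dist (x : H) L) ^+ 2)%:E)%E | L in AG H d].

End BorelMeasures.

Section PolarCurvature.
Context {R : realType} {H : normedModType R}.
Variables (dot : {dot H for idfun}) (d : nat).
Implicit Types (X : d.+2.-tuple H) (i j : 'I_d.+2).

Definition edge X i j : R := `|tnth X i - tnth X j|.

Definition tdiam X : R :=
  \big[Num.max/0]_(ij : 'I_d.+2 * 'I_d.+2 | ij.1 != ij.2) edge X ij.1 ij.2.

(* The default value tdiam X is itself an edge length. *)
Definition tmin X : R :=
  \big[Num.min/tdiam X]_(ij : 'I_d.+2 * 'I_d.+2 | ij.1 != ij.2)
    edge X ij.1 ij.2.

Definition gram X : 'M[R]_d.+1 :=
  \matrix_(i, j) dot (tnth X (lift ord0 i) - tnth X ord0)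
                     (tnth X (lift ord0 j) - tnth X ord0).

(* M_{d+1}(X); the Gram determinant does not depend on the base vertex. *)
Definition parvol X : R := Num.sqrt (\det (gram X)).

(* The polar sine of X at its i-th vertex *)
Definition psin X i : R :=
  if 0 < tmin X then parvol X / \prod_(j < d.+2 | j != i) edge X j i else 0.

Definition cpol X : R :=
  tdiam X * Num.sqrt ((\sum_(i < d.+2) psin X i ^+ 2) / d.+2%:R).

End PolarCurvature.

Section PowerMeasure.
Context {dsp : measure_display} {T : measurableType dsp} {R : realType}.
Variable mu : probability T R.

Definition tuple_cons (n : nat) (x : T * n.-tuple T) : n.+1.-tuple T :=
  [the n.+1.-tuple T of x.1 :: x.2].

Lemma measurable_tuple_cons n : measurable_fun setT (@tuple_cons n).
Proof. exact: measurable_cons. Qed.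

HB.instance Definition _ n := isMeasurableFun.Build _ _ _ _
  (@tuple_cons n) (@measurable_tuple_cons n).

(* The n-fold product measure mu^n; see power_measureE for its values on boxes. *)
Fixpoint power_measure (n : nat) : probability (n.-tuple T) R :=
  match n with
  | 0 => dirac [tuple]
  | n'.+1 => distribution (mu \x power_measure n')%E (@tuple_cons n')
  end.

Lemma power_measureE n (A : 'I_n -> set T) : (forall i, measurable (A i)) ->
  power_measure n [set x | forall i, A i (tnth x i)] =
  (\prod_(i < n) mu (A i))%E.
Proof.
elim: n A => [|n IH] A mA.
  rewrite big_ord0 (_ : [set _ | _] = setT) ?probability_setT//.
  by apply/seteqP; split => // x _ [].
rewrite big_ord_recl -(IH (fun i => A (lift ord0 i))) //.
have mS : measurable [set y : n.-tuple T | forall i, A (lift ord0 i) (tnth y i)].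
  rewrite (_ : [set _ | _] =
    \bigcap_(i : 'I_n) ((fun y => tnth y i) @^-1` A (lift ord0 i))).
    apply: fin_bigcap_measurable; first exact: finite_finset.
    move=> i _; rewrite -[X in measurable X]setTI.
    exact: measurable_tnth.
  by apply/seteqP; split => [y Ay i _|y Ay i]; [exact: Ay|exact: (Ay i)].
rewrite -product_measure1E //=.
rewrite /distribution /pushforward; congr (product_measure1 _ _ _).
apply/seteqP; split => [[x y] /= Axy|[x y] /= [Ax Ay] i].
  split => [|i]; first by have := Axy ord0; rewrite tnth0.
  by have := Axy (lift ord0 i); rewrite tnthS.
case: (unliftP ord0 i) => [j ->|->]; first by rewrite tnthS; exact: Ay.
by rewrite tnth0.
Qed.

End PowerMeasure.

(* Main.v *)
(* For a d-flat L, the unit edges of X at a vertex x_i are within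
   (dist(x_k, L) + dist(x_i, L)) / |x_k - x_i| of d + 1 vectors in a d-dimensional
   space.  These are dependent, so Hadamard's inequality bounds the polar sine at
   x_i by the sum of these errors, and
     c_pol^2(X) <= 2 diam(X)^2
       sum_{k != i} (dist^2(x_k, L) + dist^2(x_i, L)) / |x_k - x_i|^2.
   If gamma > 2, upper regularity bounds the integral of |x - y|^-2 over y uniformly
   in x (sum over dyadic annuli), and integrating the above gives case (i).
   In case (ii) upper regularity alone suffices.  As gamma > 1, a tube of small
   radius delta around a line, cut into O(diam / delta) pieces of diameter O(delta),
   has measure O(diam delta^(gamma - 1)) <= 1/2.  Hence e_2^2(mu, 1) is bounded below
   by a constant, while c_pol <= diam(mu) on the support. *)

Require Import Defs.
From HB Require Import structures.
From mathcomp Require Import all_boot all_order all_algebra sesquilinear perm.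
From mathcomp Require Import all_classical all_reals all_analysis.
From mathcomp Require Import measurable_realfun.
From mathcomp Require Import ring lra.

Set Implicit Arguments.
Unset Strict Implicit.
Unset Printing Implicit Defensive.

Import Order.TTheory GRing.Theory Num.Theory.
Import numFieldNormedType.Exports.

Local Open Scope classical_set_scope.
Local Open Scope ring_scope.

(** * Gram determinants and the polar sine *)

(** The cofactors along row [k] do not see that row, so they agree with those of the identity matrix
    and can be read off its adjugate. *)
Lemma det_replaced_row (R : comNzRingType) (n : nat) (k : 'I_n) (c : 'I_n -> R) :
  \det (\matrix_(i, j) if i == k then c j else (i == j)%:R) = c k.
Proof.
rewrite (expand_det_row _ k) (bigD1 k) //= big1 ?addr0 => [|j jk].
  rewrite mxE eqxx (_ : cofactor _ k k = cofactor 1%:M k k).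
    have /matrixP/(_ k k) := @adj1 R n.
    by rewrite !mxE eqxx => ->; rewrite mulr1.
  congr (_ * \det _); apply/matrixP => a b; rewrite !mxE.
  by rewrite [_ == k]eq_sym (negPf (neq_lift _ _)).
rewrite (_ : cofactor _ k j = cofactor 1%:M k j).
  have /matrixP/(_ j k) := @adj1 R n.
  by rewrite !mxE (negPf jk) => ->; rewrite mulr0.
congr (_ * \det _); apply/matrixP => a b; rewrite !mxE.
by rewrite [_ == k]eq_sym (negPf (neq_lift _ _)).
Qed.

(* More vectors than the dimension of the ambient space are linearly dependent;
   the coefficients are normalised so that the largest one is 1. *)
Lemma normalized_dependence (R : realFieldType) (n : nat) (A : 'M[R]_(n.+1, n)) :
  exists (c : 'I_n.+1 -> R) (k : 'I_n.+1), [/\ c k = 1, forall j, `|c j| <= 1 &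
    forall l, \sum_j c j * A j l = 0].
Proof.
have : kermx A != 0.
  by rewrite -mxrank_eq0 mxrank_ker -lt0n subn_gt0 ltnS rank_leq_col.
case/rowV0Pn => v /sub_kermxP vA v0.
have [k _ kmax] := @Order.TotalTheory.arg_maxP _ R _ ord0 xpredT
  (fun j => `|v 0 j|) isT.
have vk0 : v 0 k != 0.
  apply: contra v0 => /eqP vk; apply/eqP/rowP => j; rewrite mxE.
  by apply/eqP; rewrite -normr_le0 (le_trans (kmax j isT)) //= vk normr0.
exists (fun j => v 0 j / v 0 k), k; split.
- by rewrite divff.
- move=> j; rewrite normrM normfV ler_pdivrMr ?normr_gt0 // mul1r.
  exact: kmax.
- move=> l; have /rowP/(_ l) := vA; rewrite !mxE => vAl.
  under eq_bigr => j _ do rewrite mulrAC.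
  by rewrite -mulr_suml vAl mul0r.
Qed.

Section Gram.
Context {R : realType} {H : normedModType R} (dot : {dot H for idfun}).
Hypothesis dotE : forall x : H, `|x| ^+ 2 = dot x x.

(* The library's linearity lemmas rewrite to forms that hide [dot] behind its
   bilinear structure; these restate them for [dot] itself. *)
Lemma dotZl (a : R) (x y : H) : dot (a *: x) y = a * dot x y.
Proof. exact: linearZl_LR. Qed.

Lemma dotZr (a : R) (x y : H) : dot x (a *: y) = a * dot x y.
Proof. exact: linearZr_LR. Qed.

Lemma dotBl (x y z : H) : dot (x - y) z = dot x z - dot y z.
Proof. exact: linearBl. Qed.

Lemma dot0l (x : H) : dot 0 x = 0.
Proof. exact: linear0l. Qed.

Lemma dot_suml (n : nat) (f : 'I_n -> H) (x : H) :
  dot (\sum_i f i) x = \sum_i dot (f i) x.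
Proof. exact: linear_sumlz. Qed.

Lemma dot_sumr (n : nat) (f : 'I_n -> H) (x : H) :
  dot x (\sum_i f i) = \sum_i dot x (f i).
Proof. exact: linear_sumr. Qed.

Definition gram_mx (n : nat) (v : 'I_n -> H) : 'M[R]_n :=
  \matrix_(i, j) dot (v i) (v j).

Lemma gram_mx_lin (m n : nat) (T : 'M[R]_(m, n)) (v : 'I_n -> H)
    (w : 'I_m -> H) : (forall i, w i = \sum_j T i j *: v j) ->
  gram_mx w = T *m gram_mx v *m T^T.
Proof.
move=> wE; apply/matrixP => i j; rewrite !mxE !wE dot_sumr.
apply: eq_bigr => b _; rewrite dotZr dot_suml !mxE /= mulrC.
by congr (_ * _); apply: eq_bigr => a _; rewrite mxE dotZl.
Qed.

Lemma gram_mx_replaced (n : nat) (k : 'I_n) (c : 'I_n -> R) (v : 'I_n -> H) :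
  \det (gram_mx (fun i => if i == k then \sum_j c j *: v j else v i)) =
  c k ^+ 2 * \det (gram_mx v).
Proof.
rewrite (@gram_mx_lin _ _ (\matrix_(i, j) if i == k then c j else (i == j)%:R) v).
  by rewrite !det_mulmx det_tr det_replaced_row; ring.
move=> i; case: eqP => [->|/eqP ik].
  by apply: eq_bigr => j _; rewrite mxE eqxx.
rewrite (bigD1 i) //= mxE (negPf ik) eqxx scale1r big1 ?addr0 // => j ji.
by rewrite mxE (negPf ik) eq_sym (negPf ji) scale0r.
Qed.

(* Subtracting from [v ord0] its orthogonal projection on the span of the other
   vectors, which exists as soon as their Gram determinant is nonzero, makes the
   Gram matrix block diagonal. *)
Lemma det_gram_mx_recl (n : nat) (v : 'I_n.+1 -> H) :
  let v' j := v (lift ord0 j) in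
  0 <= \det (gram_mx v') ->
  0 <= \det (gram_mx v) <= `|v ord0| ^+ 2 * \det (gram_mx v').
Proof.
move=> v' G'0; pose G' := gram_mx v'.
have [G'eq0|G'neq0] := eqVneq (\det G') 0.
  suff -> : \det (gram_mx v) = 0 by rewrite lexx G'eq0 mulr0 lexx.
  (* A kernel vector of [G'] gives a combination [s] of the [v'] orthogonal to each of them, hence
     to itself. So [s = 0], and the same coefficients, extended by 0 at [ord0], annihilate the
     larger Gram matrix. *)
  have /eqP/det0P[c c0 cG'] := G'eq0.
  pose s := \sum_j c 0 j *: v' j.
  have sv' i : dot s (v' i) = 0.
    have /rowP/(_ i) := cG'; rewrite !mxE => cGi.
    rewrite dot_suml -[RHS]cGi; apply: eq_bigr => j _.
    by rewrite dotZl mxE.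
  have s0 : s = 0.
    apply/eqP; rewrite -normr_eq0 -sqrf_eq0 dotE {2}/s dot_sumr big1 // => j _.
    by rewrite dotZr sv' /= mulr0.
  apply/eqP/det0P; exists (\row_j if unlift ord0 j is Some j' then c 0 j' else 0).
    apply: contra c0 => /eqP/rowP u0; apply/eqP/rowP => j.
    by have := u0 (lift ord0 j); rewrite !mxE liftK.
  apply/rowP => i; rewrite !mxE big_ord_recl !mxE unlift_none mul0r add0r.
  rewrite -[RHS](dot0l (v i)) -s0 dot_suml.
  by apply: eq_bigr => j _; rewrite !mxE liftK dotZl.
have G'unit : G' \in unitmx by rewrite unitmxE unitfE.
(* The normal equations: [p] is the projection of [v ord0] and [r] the residual. *)
pose a := (\row_i dot (v ord0) (v' i)) *m invmx G'.
pose p := \sum_j a 0 j *: v' j; pose r := v ord0 - p.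
have rv' i : dot r (v' i) = 0.
  rewrite dotBl dot_suml; apply/eqP; rewrite subr_eq0; apply/eqP.
  have /rowP/(_ i) := mulmxKV G'unit (\row_i dot (v ord0) (v' i)).
  rewrite -/a [LHS]mxE [RHS]mxE => <-; apply: eq_bigr => j _.
  by rewrite [G' j i]mxE dotZl.
have rp : dot r p = 0.
  by rewrite dot_sumr big1 // => j _; rewrite dotZr rv' /= mulr0.
have rle : `|r| ^+ 2 <= `|v ord0| ^+ 2.
  rewrite (_ : v ord0 = r + p); last by rewrite subrK.
  have rpD : dot (r + p) (r + p) = dot r r + dot p p by exact: hnormDd.
  by rewrite !dotE rpD -!dotE lerDl sqr_ge0.
(* The coefficient at [ord0] is 1, so replacing [v ord0] by [r] keeps the determinant; the first row
   then vanishes off the diagonal. *)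
pose c i := if unlift ord0 i is Some j then - a 0 j else 1.
have := gram_mx_replaced ord0 c v; rewrite {2}/c unlift_none expr1n mul1r => <-.
have -> : \sum_j c j *: v j = r.
  rewrite big_ord_recl /c unlift_none scale1r; congr (_ + _).
  by rewrite -sumrN; apply: eq_bigr => j _; rewrite liftK scaleNr.
rewrite (expand_det_row _ ord0) big_ord_recl big1 ?addr0 => [|j _]; last first.
  by rewrite mxE eqxx -[lift _ _ == _]/(false) rv' mul0r.
rewrite mxE eqxx -dotE /cofactor expr0 mul1r.
rewrite (_ : row' _ _ = G'); last by apply/matrixP => i j; rewrite !mxE.
by rewrite mulr_ge0 ?sqr_ge0 //= ler_wpM2r.
Qed.

Lemma det_gram_mx_ge0 (n : nat) (v : 'I_n -> H) : 0 <= \det (gram_mx v).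
Proof.
elim: n v => [|n IH] v; first by rewrite det_mx00.
by have /andP[] := det_gram_mx_recl (IH (fun j => v (lift ord0 j))).
Qed.

Lemma hadamard (n : nat) (v : 'I_n -> H) :
  \det (gram_mx v) <= \prod_i `|v i| ^+ 2.
Proof.
elim: n v => [|n IH] v; first by rewrite det_mx00 big_ord0.
rewrite big_ord_recl.
have /andP[_ /le_trans] := det_gram_mx_recl (det_gram_mx_ge0 (fun j => v (lift ord0 j))).
by apply; rewrite ler_wpM2l ?sqr_ge0.
Qed.

(* If the [q j] lie in an n-dimensional space, some combination of them with
   coefficients at most 1 vanishes, so one of the [v j] may be replaced, up to
   a combination of the others, by a combination of the [v j - q j]. *)
Lemma det_gram_mx_unit_le (n : nat) (v q : 'I_n.+1 -> H) (u : 'I_n -> H) :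
  (forall j, `|v j| <= 1) ->
  (forall j, exists a : 'I_n -> R, q j = \sum_l a l *: u l) ->
  \det (gram_mx v) <= (\sum_j `|v j - q j|) ^+ 2.
Proof.
move=> v1 /choice[a qE].
have [c [k [ck1 cle cA]]] := normalized_dependence (\matrix_(j, l) a j l).
have cq : \sum_j c j *: q j = 0.
  transitivity (\sum_j \sum_l (c j * a j l) *: u l).
    apply: eq_bigr => j _; rewrite qE scaler_sumr.
    by apply: eq_bigr => l _; rewrite scalerA.
  rewrite exchange_big big1 // => l _; rewrite -scaler_suml.
  rewrite (_ : \sum_i _ = 0) ?scale0r // -[RHS](cA l).
  by apply: eq_bigr => j _; rewrite mxE.
have := gram_mx_replaced k c v; rewrite ck1 expr1n mul1r => <-.
apply: le_trans (hadamard _) _; rewrite (bigD1 k) //= eqxx.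
rewrite -[leRHS]mulr1; apply: ler_pM.
- exact: sqr_ge0.
- by apply: prodr_ge0 => i _; rewrite sqr_ge0.
- have -> : \sum_j c j *: v j = \sum_j c j *: (v j - q j).
    under [RHS]eq_bigr => j _ do rewrite scalerBr.
    by rewrite sumrB cq subr0.
  rewrite ler_sqr ?nnegrE ?sumr_ge0 //.
  apply: le_trans (ler_norm_sum _ _ _) _; apply: ler_sum => j _.
  by rewrite normrZ ler_piMl.
- apply: prodr_ile1 => i ik; rewrite (negPf ik) sqr_ge0 /=.
  by rewrite exprn_ile1.
Qed.

Lemma det_gram_mx_scale (n : nat) (c : 'I_n -> R) (v : 'I_n -> H) :
  \det (gram_mx (fun i => c i *: v i)) = (\prod_i c i) ^+ 2 * \det (gram_mx v).
Proof.
rewrite (@gram_mx_lin _ _ (diag_mx (\row_j c j)) v) => [|i].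
  rewrite !det_mulmx det_tr det_diag.
  by under eq_bigr => j _ do rewrite mxE; ring.
rewrite (bigD1 i) //= !mxE eqxx mulr1n big1 ?addr0 // => j ji.
by rewrite !mxE eq_sym (negPf ji) mulr0n scale0r.
Qed.

End Gram.

(** Cauchy-Schwarz against the constant 1: the square is expanded and each product is bounded by the
    mean of the two squares. *)
Lemma sqr_sum_le (R : realFieldType) (I : finType) (P : pred I) (f : I -> R) :
  (\sum_(i | P i) f i) ^+ 2 <= #|P|%:R * \sum_(i | P i) f i ^+ 2.
Proof.
rewrite expr2 big_distrlr /=.
have le2 i j : f i * f j <= 2^-1 * (f i ^+ 2 + f j ^+ 2).
  have := sqr_ge0 (f i - f j); rewrite sqrrB => h.
  by lra.
apply: (@le_trans _ _ (\sum_(i | P i) \sum_(j | P j)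
    2^-1 * (f i ^+ 2 + f j ^+ 2))).
  by apply: ler_sum => i _; apply: ler_sum => j _.
have inner i : \sum_(j | P j) 2^-1 * (f i ^+ 2 + f j ^+ 2) =
    2^-1 * (f i ^+ 2 *+ #|P| + \sum_(j | P j) f j ^+ 2).
  by rewrite -mulr_sumr big_split /= sumr_const.
rewrite (eq_bigr _ (fun i _ => inner i)) -mulr_sumr big_split /= sumr_const.
rewrite sumrMnl -[X in X + _]mulr_natl -[X in _ + X]mulr_natl; lra.
Qed.

(** * Distance to a flat *)

Section DistanceToFlat.
Context {R : realType} {H : normedModType R}.

Lemma dist_ge0 (x : H) (L : set H) : 0 <= dist x L.
Proof.
rewrite /dist; have [->|/set0P L0] := eqVneq L set0.
  by rewrite image_set0 inf0.
apply: lb_le_inf => [|_ [y Ly <-]]; last exact: normr_ge0.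
by case: L0 => y Ly; exists `|x - y|, y.
Qed.

Lemma dist_approx (x : H) (L : set H) (e : R) : L !=set0 -> 0 < e ->
  exists2 y, L y & `|x - y| < dist x L + e.
Proof.
move=> L0 e0.
have [|_ [y Ly <-] yle] := @inf_adherent _ [set `|x - y| | y in L] e e0.
  split; first by case: L0 => y Ly; exists `|x - y|, y.
  by exists 0 => _ [y Ly <-].
by exists y.
Qed.

Lemma AG_nonempty (d : nat) (L : set H) : AG H d L -> L !=set0.
Proof. by move=> [p [v [_ ->]]]; exists (p + \sum_(i < d) 0 *: v i), (fun=> 0). Qed.

End DistanceToFlat.

(** * Bounds on the polar sine and the polar curvature *)

Section PolarSine.
Context {R : realType} {H : normedModType R} (dot : {dot H for idfun}) (d : nat).
Hypothesis dotE : forall x : H, `|x| ^+ 2 = dot x x.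
Implicit Types (X : d.+2.-tuple H) (i j : 'I_d.+2).

Lemma edge_le_tdiam X i j : i != j -> edge X i j <= tdiam X.
Proof.
by move=> ij; exact: (@le_bigmax_cond _ _ _ _ (i, j) _ (fun ij => edge X ij.1 ij.2)).
Qed.

(** Exchanging 0 and [i] turns the enumeration [lift ord0] of the nonzero indices into one of the
    indices other than [i]. For [i = ord0] these are the vectors of [gram]. *)
Definition rebase i X : 'I_d.+1 -> H :=
  fun a => tnth X (tperm ord0 i (lift ord0 a)) - tnth X i.

Lemma det_gram_rebase i X :
  \det (gram dot X) = \det (gram_mx dot (rebase i X)).
Proof.
pose v a := tnth X (lift ord0 a) - tnth X ord0.
have -> : gram dot X = gram_mx dot v by apply/matrixP => a b; rewrite !mxE.
have [m ->|->] := unliftP ord0 i; last first.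
  congr (\det (gram_mx _ _)); apply/funext => a.
  by rewrite /rebase tperm1 perm1.
(* With base vertex [lift ord0 m], the vectors are [v a - v m] for [a != m] and [- v m] for [a = m].
   Hence column [m] of the transition matrix is constantly -1; its determinant is -1, which enters
   squared. *)
pose T : 'M[R]_d.+1 := (\matrix_(a, b) if a == m then -1 else (a == b)%:R)^T.
rewrite (@gram_mx_lin _ _ _ _ _ T v) => [|a].
  by rewrite !det_mulmx !det_tr (det_replaced_row m (fun=> -1)); ring.
have [->|am] := eqVneq a m.
  rewrite /rebase tpermR (bigD1 m) //= !mxE eqxx big1 => [|b bm].
    by rewrite addr0 scaleN1r /v opprB.
  by rewrite !mxE (negPf bm) scale0r.
rewrite /rebase tpermD ?(inj_eq lift_inj) //; last by rewrite eq_sym.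
rewrite (bigD1 a) //= (bigD1 m) 1?eq_sym //= big1 => [|b /andP[ba bm]].
  rewrite !mxE eqxx (negPf am) eqxx addr0 scale1r scaleN1r /v.
  by rewrite opprB addrA subrK.
by rewrite !mxE (negPf bm) (negPf ba) scale0r.
Qed.

Lemma big_rebase (V : Type) (idx : V) (op : Monoid.com_law idx) i (F : 'I_d.+2 -> V) :
  \big[op/idx]_(j | j != i) F j =
  \big[op/idx]_(a < d.+1) F (tperm ord0 i (lift ord0 a)).
Proof.
rewrite (reindex_inj (@perm_inj _ (tperm ord0 i))) /=.
rewrite big_mkcond big_ord_recl /= tpermL eqxx Monoid.mul1m.
apply: eq_bigr => a _; rewrite ifT // -[X in _ != X](tpermL ord0 i).
by rewrite (inj_eq perm_inj) eq_sym neq_lift.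
Qed.

Definition unit_rebase i X : 'I_d.+1 -> H :=
  fun a => `|rebase i X a|^-1 *: rebase i X a.

Lemma norm_unit_rebase i X (a : 'I_d.+1) : `|unit_rebase i X a| <= 1.
Proof.
rewrite normrZ normfV normr_id; have [->|r0] := eqVneq `|rebase i X a| 0.
  by rewrite mulr0.
by rewrite mulVf.
Qed.

Lemma psin_ge0 X i : 0 <= psin dot X i.
Proof.
rewrite /psin; case: ifP => // _.
by rewrite divr_ge0 ?sqrtr_ge0 // prodr_ge0 // => j _; exact: normr_ge0.
Qed.

(** Normalising the edges at [i] divides the Gram determinant by the squared product of their
    lengths. Bounds for vectors of norm at most 1 thereby apply to the polar sine. *)
Lemma psin_sqr X i : 0 < tmin X ->
  psin dot X i ^+ 2 = \det (gram_mx dot (unit_rebase i X)).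
Proof.
move=> X0; rewrite /psin X0 det_gram_mx_scale // expr_div_n sqr_sqrtr; last first.
  by rewrite (det_gram_rebase i) det_gram_mx_ge0.
rewrite (det_gram_rebase i) big_rebase mulrC; congr (_ * _).
by rewrite prodfV exprVn; congr (_ ^-1).
Qed.

Lemma psin_sqr_le1 X i : psin dot X i ^+ 2 <= 1.
Proof.
have [X0|X0] := ltP 0 (tmin X); last by rewrite /psin ltNge X0 /= expr0n ler01.
rewrite psin_sqr //; apply: le_trans (hadamard dotE _) _.
apply: prodr_ile1 => a _; rewrite sqr_ge0 /=.
by rewrite exprn_ile1 // norm_unit_rebase.
Qed.

Lemma psin_le_dist X i (L : set H) : AG H d L ->
  psin dot X i <=
  \sum_(k | k != i) (dist (tnth X k) L + dist (tnth X i) L) / edge X k i.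
Proof.
move=> LAG; have dpos k : 0 <= dist (tnth X k) L by exact: dist_ge0.
have [X0|X0] := ltP 0 (tmin X); last first.
  rewrite /psin ltNge X0 /=; apply: sumr_ge0 => k _.
  by rewrite divr_ge0 ?addr_ge0 // normr_ge0.
pose s := \sum_(k | k != i) (edge X k i)^-1.
have s0 : 0 <= s by apply: sumr_ge0 => k _; rewrite invr_ge0 normr_ge0.
apply/ler_addgt0Pr => e e0.
(* Points of [L] nearly realising the distances replace projections. Their total cost is
   [2 * e' * s = e * (s / (s + 1))], at most [e]. *)
pose e' := e / (2 * (s + 1)).
have e'0 : 0 < e' by rewrite divr_gt0 // mulr_gt0 // ltr_wpDl.
have /choice[y yP] k : exists z, L z /\ `|tnth X k - z| < dist (tnth X k) L + e'.
  by have [z Lz zlt] := dist_approx (tnth X k) (AG_nonempty LAG) e'0; exists z.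
have [p [u [_ LE]]] := LAG.
(* In a difference of two points of [L] the base point [p] cancels, so all [q a] lie in the span of
   the [d] vectors [u]. *)
pose q a := `|rebase i X a|^-1 *: (y (tperm ord0 i (lift ord0 a)) - y i).
have qspan a : exists c : 'I_d -> R, q a = \sum_l c l *: u l.
  have := (yP i).1; rewrite {1}LE => -[c1 y1].
  have := (yP (tperm ord0 i (lift ord0 a))).1; rewrite {1}LE => -[c2 y2].
  exists (fun l => `|rebase i X a|^-1 * (c2 l - c1 l)).
  rewrite /q y1 y2 opprD addrACA subrr add0r -sumrB scaler_sumr.
  by apply: eq_bigr => l _; rewrite -scalerBl scalerA.
have := det_gram_mx_unit_le dotE (norm_unit_rebase i X) qspan.
rewrite -psin_sqr // ler_sqr ?nnegrE ?psin_ge0 ?sumr_ge0 // => /le_trans; apply.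
apply: (@le_trans _ _ (\sum_(k | k != i)
    (dist (tnth X k) L + dist (tnth X i) L + 2 * e') / edge X k i)).
  rewrite big_rebase; apply: ler_sum => a _.
  rewrite -scalerBr normrZ normfV normr_id mulrC ler_wpM2r ?invr_ge0 //.
  have -> : rebase i X a - (y (tperm ord0 i (lift ord0 a)) - y i) =
      (tnth X (tperm ord0 i (lift ord0 a)) - y (tperm ord0 i (lift ord0 a))) -
      (tnth X i - y i) by rewrite /rebase !opprD !opprK !addrA [X in X + _]addrAC.
  apply: le_trans (ler_normB _ _) _.
  have := (yP i).2; have := (yP (tperm ord0 i (lift ord0 a))).2; lra.
under eq_bigr => k _ do rewrite mulrDl.
rewrite big_split /= -mulr_sumr lerD2l -/s /e'.
rewrite [leLHS](_ : _ = e * (s / (s + 1))); last by field; lra.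
by rewrite ler_piMr ?(ltW e0) // ler_pdivrMr ?mul1r ?lerDl // ltr_wpDl.
Qed.

Lemma cpol_sqrE X :
  cpol dot X ^+ 2 = tdiam X ^+ 2 * ((\sum_i psin dot X i ^+ 2) / d.+2%:R).
Proof.
rewrite exprMn sqr_sqrtr // divr_ge0 ?ler0n // sumr_ge0 // => i _.
exact: sqr_ge0.
Qed.

Lemma cpol_sqr_le_tdiam X : cpol dot X ^+ 2 <= tdiam X ^+ 2.
Proof.
rewrite cpol_sqrE ler_piMr ?sqr_ge0 // ler_pdivrMr ?ltr0n // mul1r.
apply: le_trans (ler_sum _ (fun i _ => psin_sqr_le1 X i)) _.
by rewrite sumr_const card_ord.
Qed.

(** Squaring [psin_le_dist] costs [d + 1] by Cauchy-Schwarz, absorbed by the average over [d + 2]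
    vertices, and 2 from separating the squares of the two distances. *)
Lemma cpol_sqr_le_dist X (L : set H) : AG H d L ->
  cpol dot X ^+ 2 <= 2 * tdiam X ^+ 2 * \sum_i \sum_(k | k != i)
    (dist (tnth X k) L ^+ 2 + dist (tnth X i) L ^+ 2) / edge X k i ^+ 2.
Proof.
move=> LAG; pose f k i := dist (tnth X k) L ^+ 2 + dist (tnth X i) L ^+ 2.
have psinle i : psin dot X i ^+ 2 <=
    d.+1%:R * (2 * \sum_(k | k != i) f k i / edge X k i ^+ 2).
  pose g k := (dist (tnth X k) L + dist (tnth X i) L) / edge X k i.
  apply: (@le_trans _ _ ((\sum_(k | k != i) g k) ^+ 2)).
    have le1 := psin_le_dist X i LAG.
    by rewrite ler_sqr ?nnegrE ?psin_ge0 // (le_trans (psin_ge0 X i) le1).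
  apply: le_trans (sqr_sum_le _ _) _.
  rewrite (_ : #|_| = d.+1); last by rewrite (cardC1 i) card_ord.
  rewrite ler_wpM2l ?ler0n // mulr_sumr; apply: ler_sum => k _.
  rewrite /g expr_div_n mulrA ler_wpM2r ?invr_ge0 ?sqr_ge0 // /f.
  have := sqr_ge0 (dist (tnth X k) L - dist (tnth X i) L); lra.
rewrite cpol_sqrE [X in _ <= X * _]mulrC -(mulrA _ 2) ler_wpM2l ?sqr_ge0 //.
have S0 : 0 <= \sum_i \sum_(k | k != i) f k i / edge X k i ^+ 2.
  apply: sumr_ge0 => i _; apply: sumr_ge0 => k _.
  by rewrite divr_ge0 ?addr_ge0 ?sqr_ge0.
rewrite ler_pdivrMr ?ltr0n //.
apply: le_trans (ler_sum _ (fun i _ => psinle i)) _.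
rewrite -mulr_sumr -mulr_sumr [leRHS]mulrC ler_wpM2r ?ler_nat //.
by rewrite mulr_ge0.
Qed.

End PolarSine.

(** * Borel sets and the support of a measure *)

Section BorelSets.
Context {R : realType} {H : normedModType R}.

Lemma open_borel (A : set H) : open A -> measurable (A : set (borel H)).
Proof. exact: sub_sigma_algebra. Qed.

Lemma closed_ball_borel (x : H) (t : R) :
  measurable (closed_ball_ Num.norm x t : set (borel H)).
Proof.
rewrite -[X in measurable X](@setCK H); apply: measurableC; apply: open_borel.
rewrite openE => y /= /negP; rewrite -ltNge => txy.
apply/nbhs_ballP; exists (`|x - y| - t) => /=; first by rewrite subr_gt0.
move=> z; rewrite -ball_normE /ball_ /= => yz /=; apply/negP; rewrite -ltNge.
have : `|x - y| <= `|x - z| + `|y - z| by rewrite (distrC y z) ler_distD.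
lra.
Qed.

Lemma lipschitz_borel (f : H -> R) : (forall x y, f x <= f y + `|x - y|) ->
  measurable_fun setT (f : borel H -> R).
Proof.
move=> fL; apply: (measurability _ (RGenInftyO.measurableE R)) => //.
move=> _ [_ [r ->] <-]; rewrite setTI; apply: open_borel.
rewrite openE => x /=; rewrite in_itv /= => fxr.
apply/nbhs_ballP; exists (r - f x) => /=; first by rewrite subr_gt0.
move=> z; rewrite -ball_normE /ball_ /= => xz; rewrite in_itv /=.
by have := fL z x; rewrite distrC; lra.
Qed.

Lemma dist_borel (L : set H) : L !=set0 ->
  measurable_fun setT ((fun x : H => dist x L) : borel H -> R).
Proof.
move=> L0; apply: lipschitz_borel => x y; apply/ler_addgt0Pr => e e0.
have [z Lz yz] := dist_approx y L0 e0.
apply: (@le_trans _ _ `|x - z|).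
  by apply: ge_inf; [exists 0 => _ [? _ <-]|exists z].
by have := ler_distD y x z; lra.
Qed.

Lemma separable_seq : separable H ->
  exists s : nat -> H, forall (x : H) (e : R), 0 < e -> exists n, `|x - s n| < e.
Proof.
move=> [S /countable_injP[f finj] Sd].
exists (fun n => xget (0 : H) [set y | S y /\ f y = n]) => x e e0.
have [|y [xy Sy]] := Sd (ball x e) _ (ball_open x e).
  by exists x; exact: ballxx.
exists (f y); case: xgetP => [z _ [Sz fzy]|/(_ y)]; last by move=> /(_ (conj Sy erefl)).
move: xy; rewrite -ball_normE /ball_ /= => xy.
by rewrite (finj z y) ?inE.
Qed.

(** The product sigma-algebra is reached through a dense sequence: [|x - y| < r] holds exactly when
    [|x - s n| + |y - s n| < r] for some [n]. Each of these countably many conditions is a sum of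
    functions of one variable. *)
Lemma measurable_norm_sub : separable H ->
  measurable_fun setT (fun z : borel H * borel H => `|(z.1 : H) - (z.2 : H)|).
Proof.
move=> /separable_seq[s sP].
apply: (measurability _ (RGenInftyO.measurableE R)) => //.
move=> _ [_ [r ->] <-]; rewrite setTI.
pose h n (z : borel H * borel H) := `|(z.1 : H) - s n| + `|(z.2 : H) - s n|.
rewrite (_ : _ @^-1` _ = \bigcup_n (h n @^-1` [set x | x < r])).
  apply: bigcup_measurable => n _; rewrite -[X in measurable X]setTI.
  have mn : measurable_fun setT ((fun x : H => `|x - s n|) : borel H -> R).
    by apply: lipschitz_borel => x y; have := ler_distD y x (s n); lra.
  have mh : measurable_fun setT (h n).
    by apply: measurable_funD; apply: (measurableT_comp mn).
  have -> : [set x | x < r] = `]-oo, r[%classic.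
    by apply/seteqP; split => x /=; rewrite in_itv.
  exact: mh.
apply/seteqP; split => [[x y] /=|[x y] [n _ /=]]; rewrite in_itv /=.
  move=> xyr; have [|n xn] := sP x ((r - `|x - y|) / 2).
    by rewrite divr_gt0 // subr_gt0.
  exists n => //=; rewrite /h /=.
  by have := ler_distD x y (s n); rewrite (distrC y x); lra.
by rewrite /h /= => hr; have := ler_distD (s n) x y; rewrite (distrC (s n)); lra.
Qed.

End BorelSets.

Section Support.
Context {R : realType} {H : normedModType R} (mu : probability (borel H) R).

Lemma open_setC_msupp : open (~` msupp mu : set H).
Proof.
rewrite openE => x /existsNP[U /not_implyP[[oU Ux] mu0]].
apply: filterS (open_nbhs_nbhs (conj oU Ux)) => y Uy.
by apply/existsNP; exists U; apply/not_implyP; split.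
Qed.

Lemma measurable_msupp : measurable (msupp mu : set (borel H)).
Proof.
rewrite -[X in measurable X](@setCK H); apply: measurableC.
exact: (open_borel open_setC_msupp).
Qed.

(** A Lindelöf argument: the complement of the support is covered by those balls that are null among
    the countably many centred at [s n] with radius [1 / (m + 1)]. *)
Lemma measure_setC_msupp : separable H -> mu (~` msupp mu) = 0%E.
Proof.
move=> /separable_seq[s sP].
have mC : measurable (~` msupp mu : set (borel H)).
  exact: (open_borel open_setC_msupp).
apply/(measure_negligible mC).
pose N nm : set (borel H) :=
  if mu (ball (s nm.1) nm.2.+1%:R^-1) == 0%E then ball (s nm.1) nm.2.+1%:R^-1
  else set0.
have mN nm : measurable (N nm).
  rewrite /N; case: ifP => _; last exact: measurable0.
  exact: (open_borel (ball_open _ _)).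
apply: (@negligibleS _ _ _ mu (\bigcup_k
    if unpickle k is Some nm then N nm else set0)).
  move=> x'; have [x <-] : exists x : H, x = x' by exists x'.
  move=> /existsNP[U /not_implyP[[oU Ux] mu0]].
  have := oU; rewrite openE => /(_ x Ux)/nbhs_ballP[e /= e0 xeU].
  have e20 : 0 < e / 2 by rewrite divr_gt0.
  (* The radius is below [e / 2], so a ball of this radius whose centre is that close to [x] stays
     in [U]. *)
  have [m _ /(_ m (leqnn m)) /= me] := near_infty_natSinv_lt (PosNum e20).
  have [n xn] := sP x m.+1%:R^-1 ltac:(by rewrite invr_gt0).
  exists (pickle (n, m)) => //=; rewrite pickleK /N /=.
  have sub : ball (s n) m.+1%:R^-1 `<=` U.
    move=> y; rewrite -ball_normE /ball_ /= => yn; apply: xeU.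
    rewrite -ball_normE /ball_ /=.
    have xe := lt_trans xn me; have ye := lt_trans yn me.
    by have := ler_distD (s n) x y; lra.
  rewrite ifT; first by rewrite -ball_normE /ball_ /= distrC.
  rewrite eq_le measure_ge0 andbT; apply: le_trans.
    apply: (le_measure mu _ _ sub); rewrite inE.
      exact: (open_borel (ball_open _ _)).
    exact: (open_borel oU).
  by rewrite leNgt; apply/negP.
apply: negligible_bigcup => k; case: unpickle => [nm|]; last exact: negligible_set0.
apply/negligibleP => //; rewrite /N; case: eqP => // _; exact: measure0.
Qed.

Lemma msupp_nonempty : separable H -> msupp mu !=set0.
Proof.
move=> sH; apply/set0P/eqP => S0.
have := measure_setC_msupp sH; rewrite S0 setC0 probability_setT.
by move=> /eqP; rewrite onee_eq0.
Qed.

Lemma le_mdiam (x y : H) : bounded_set (msupp mu) ->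
  msupp mu x -> msupp mu y -> `|x - y| <= mdiam mu.
Proof.
move=> [M [Mr MP]] Sx Sy.
apply: ub_le_sup; last by exists x => //; exists y.
exists ((M + 1) + (M + 1)) => _ [a Sa [b Sb <-]].
apply: le_trans (ler_normB _ _) _.
by apply: lerD; apply: MP => //; rewrite ltrDl.
Qed.

Lemma mdiam_ge0 : bounded_set (msupp mu) -> separable H -> 0 <= mdiam mu.
Proof.
move=> bS /msupp_nonempty[x Sx].
by have := le_mdiam bS Sx Sx; rewrite subrr normr0.
Qed.

End Support.

(** * Integration against power measures *)

Section NonnegativeIntegrals.
Local Open Scope ereal_scope.
Import HBNNSimple.

(* Unlike [ge0_le_integral], no measurability is needed: the integral of a
   nonnegative function is a supremum over simple functions below it. *)
Lemma ge0_le_integralT d (T : measurableType d) (R : realType)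
    (mu : {measure set T -> \bar R}) (f g : T -> \bar R) :
  (forall x, 0 <= f x) -> (forall x, f x <= g x) ->
  \int[mu]_x f x <= \int[mu]_x g x.
Proof.
move=> f0 fg; rewrite !ge0_integralTE //; last first.
  by move=> x; exact: le_trans (f0 x) (fg x).
apply: ereal_sup_le => _ [h hf <-]; exists h => // x; exact: le_trans (hf x) (fg x).
Qed.

Context {dsp : measure_display} {T : measurableType dsp} {R : realType}.
Variable mu : probability T R.

Lemma integral_power_measureS n (f : n.+1.-tuple T -> \bar R) :
  measurable_fun setT f -> (forall X, 0 <= f X) ->
  \int[power_measure mu n.+1]_X f X =
  \int[mu]_x \int[power_measure mu n]_Y f (tuple_cons (x, Y)).
Proof.
move=> mf f0; rewrite /= ge0_integral_distribution //.
rewrite (fubini_tonelli1 (f \o @tuple_cons _ T n)) //=.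
exact: measurableT_comp mf (@measurable_tuple_cons _ T n).
Qed.

Lemma tnth_tuple_cons0 n (z : T * n.-tuple T) : tnth (tuple_cons z) ord0 = z.1.
Proof. by rewrite tnth0. Qed.

Lemma tnth_tuple_consS n (z : T * n.-tuple T) i :
  tnth (tuple_cons z) (lift ord0 i) = tnth z.2 i.
Proof. by rewrite tnthS. Qed.

Lemma integral_cst_probability d (U : measurableType d) (P : probability U R)
    (c : \bar R) : \int[P]_x c = c.
Proof.
rewrite integral_cst // -[RHS]mule1; congr (_ * _).
exact: probability_setT.
Qed.

Lemma integral_power_measure_tnth n (i : 'I_n) (g : T -> \bar R) :
  measurable_fun setT g -> (forall x, 0 <= g x) ->
  \int[power_measure mu n]_X g (tnth X i) = \int[mu]_x g x.
Proof.
move=> mg g0; elim: n i => [[]//|n IH] i.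
rewrite integral_power_measureS //; last first.
  exact: measurableT_comp mg (measurable_tnth i).
have [j ->|->] := unliftP ord0 i.
  rewrite -[RHS](integral_cst_probability mu); apply: eq_integral => x _.
  by rewrite -(IH j); apply: eq_integral => Y _; rewrite tnth_tuple_consS.
apply: eq_integral => x _; under eq_integral => Y _ do rewrite tnth_tuple_cons0 /=.
exact: integral_cst_probability.
Qed.

Lemma integral_power_measure_tnth2 n (i j : 'I_n) (g : T * T -> \bar R) :
  i != j -> measurable_fun setT g -> (forall x, 0 <= g x) ->
  \int[power_measure mu n]_X g (tnth X i, tnth X j) =
  \int[mu]_x \int[mu]_y g (x, y).
Proof.
move=> + mg g0; elim: n i j => [[]//|n IH] i j.
move=> ij; rewrite integral_power_measureS //; last first.
  apply: measurableT_comp mg _.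
  by apply: measurable_fun_pair; exact: measurable_tnth.
move: ij; have [i' ->|->] := unliftP ord0 i; have [j' ->|->] := unliftP ord0 j.
- rewrite (inj_eq lift_inj) => ij.
  rewrite -[RHS](integral_cst_probability mu); apply: eq_integral => x _.
  by rewrite -(IH i' j') //; apply: eq_integral => Y _; rewrite !tnth_tuple_consS.
(* The head of the tuple is here the second argument of [g], so Tonelli exchanges the order of
   integration. *)
- move=> _; rewrite fubini_tonelli //.
  apply: eq_integral => x _.
  under eq_integral => Y _ do rewrite tnth_tuple_consS tnth_tuple_cons0.
  rewrite (@integral_power_measure_tnth n i' (fun y => g (y, x))) //.
  exact: measurableT_comp mg (measurable_pair2 _).
- move=> _; apply: eq_integral => x _.
  under eq_integral => Y _ do rewrite tnth_tuple_consS tnth_tuple_cons0.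
  rewrite (@integral_power_measure_tnth n j' (fun y => g (x, y))) //.
  exact: measurableT_comp mg (measurable_pair1 _).
- by rewrite eqxx.
Qed.

End NonnegativeIntegrals.

(** Since [e2] is an infimum of square roots, the square root of [E / K] is compared with each of
    them, and squaring comes last. *)
Lemma le_mul_e2_sqr (R : realType) (H : normedModType R)
    (mu : probability (borel H) R) (d : nat) (E K : R) : 0 <= E -> 0 < K ->
  (forall L, AG H d L ->
    (E%:E <= K%:E * \int[mu]_x ((dist (x : H) L) ^+ 2)%:E)%E) ->
  (E%:E <= K%:E * e2 mu d ^+ 2)%E.
Proof.
move=> E0 K0 EL; rewrite -lee_pdivrMl //.
have EK0 : 0 <= K^-1 * E by rewrite mulr_ge0 // invr_ge0 ltW.
have le : ((Num.sqrt (K^-1 * E))%:E <= e2 mu d)%E.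
  apply: le_ereal_inf_tmp => _ [L LAG <-].
  have := EL L LAG; rewrite -lee_pdivrMl // -EFinM.
  case: (\int[mu]_x _)%E => [r| |] //=.
    by rewrite !lee_fin => h; rewrite ler_wsqrtr.
  by move=> _; rewrite leey.
rewrite -EFinM -[X in X%:E](sqr_sqrtr EK0) EFin_expe.
by rewrite lee_sqr // ?lee_fin ?sqrtr_ge0 // (le_trans _ le) // lee_fin sqrtr_ge0.
Qed.

(** * The singular kernel *)

Section InfiniteOnNullSet.
Context {d : measure_display} {T : measurableType d} {R : realType}.

(* Adding [infty_on N] to an upper bound makes a bound valid off [N] valid
   everywhere, at no cost when [N] is null. *)
Definition infty_on (N : set T) (x : T) : \bar R :=
  if x \in N then +oo%E else 0%E.

Lemma infty_on_ge0 (N : set T) (x : T) : (0 <= infty_on N x)%E.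
Proof. by rewrite /infty_on; case: ifP. Qed.

Lemma measurable_infty_on (N : set T) : measurable N ->
  measurable_fun setT (infty_on N).
Proof.
move=> mN; apply: measurable_fun_ifT => //.
apply: (measurable_fun_bool true); rewrite setTI.
rewrite (_ : _ @^-1` _ = N) //; apply/seteqP.
by split => x /=; [exact: set_mem|exact: mem_set].
Qed.

Lemma integral_infty_on (mu : {measure set T -> \bar R}) (N : set T) :
  measurable N -> mu N = 0%E -> (\int[mu]_x infty_on N x = 0)%E.
Proof.
move=> mN N0; rewrite (@ae_eq_integral _ _ _ mu setT (cst 0%E)) ?integral0 //.
  exact: measurable_infty_on.
exists N; split => // x /= xN; apply: contrapT => Nx; apply: xN => _.
by rewrite /infty_on memNset.
Qed.

End InfiniteOnNullSet.

Lemma nneseries_geometric_le (R : realType) (A q : R) : 0 <= A -> 0 <= q < 1 ->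
  (\sum_(k <oo) (A * q ^+ k)%:E <= (A / (1 - q))%:E)%E.
Proof.
move=> A0 /andP[q0 q1]; apply: lime_le.
  by apply: is_cvg_nneseries => n _ _; rewrite lee_fin mulr_ge0 // exprn_ge0.
apply: nearW => n; rewrite sumEFin lee_fin.
suff -> : \sum_(0 <= i < n) A * q ^+ i = A * (1 - q ^+ n) / (1 - q).
  rewrite ler_wpM2r ?invr_ge0 ?subr_ge0 ?(ltW q1) // ler_piMr //.
  by rewrite gerBl exprn_ge0.
elim: n => [|n IH]; first by rewrite big_nil expr0 subrr mulr0 mul0r.
by rewrite big_nat_recr //= IH exprS; field; rewrite subr_eq0 eq_sym lt_eqF.
Qed.

(** The least [k] satisfying the lower inequality works: minimality gives the upper one, or [r <= D]
    does when [k = 0]. *)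
Lemma dyadic_scale (R : realType) (D r : R) : 0 < r <= D ->
  exists k, D * 2^-1 ^+ k.+1 < r <= D * 2^-1 ^+ k.
Proof.
move=> /andP[r0 rD].
have D0 : 0 < D := lt_le_trans r0 rD.
have ex : exists k, D * 2^-1 ^+ k.+1 < r.
  exists (Num.bound (D / r)).
  rewrite exprVn ltr_pdivrMr ?exprn_gt0 // mulrC -ltr_pdivrMr //.
  apply: lt_trans (archi_boundP _) _; first by rewrite divr_ge0 ?ltW.
  rewrite -natrX ltr_nat; apply: ltn_trans (ltn_expl _ (isT : (1 < 2)%N)) _.
  by rewrite ltn_exp2l.
exists (ex_minn ex); case: ex_minnP => -[|k] kr kmin.
  by rewrite kr expr0 mulr1.
rewrite kr leNgt; apply/negP => h.
by have := kmin _ h; rewrite ltnn.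
Qed.

Section KernelBound.
Context {R : realType} {H : normedModType R} (mu : probability (borel H) R).
Variables (gamma C : R).

(** The sum of a geometric series of ratio 2^(2 - gamma), one term per dyadic annulus. The 4 arises
    because the inner radius of an annulus is half the outer one. *)
Definition kernel_bound (D : R) : R :=
  4 * C * D `^ gamma / D ^+ 2 / (1 - 2^-1 `^ (gamma - 2)).

Hypothesis gamma_gt2 : 2 < gamma.
Hypothesis C_ge0 : 0 <= C.

Lemma half_powR_lt1 : 0 <= (2^-1 : R) `^ (gamma - 2) < 1.
Proof.
rewrite powR_ge0 /= [X in _ < X](_ : 1 = 1 `^ (gamma - 2)); last by rewrite powR1.
by rewrite gt0_ltr_powR ?nnegrE ?subr_gt0 ?invr_ge0 // invf_lt1 // ltr1n.
Qed.

Lemma kernel_bound_ge0 (D : R) : 0 <= kernel_bound D.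
Proof.
have /andP[_ /ltW q1] := half_powR_lt1.
apply: divr_ge0; last by rewrite subr_ge0.
by apply: divr_ge0; rewrite ?sqr_ge0 // !mulr_ge0 ?powR_ge0.
Qed.

(** On the k-th annulus around [x] the kernel is at most [c k], the inverse square of the inner
    radius. Enlarging the annulus to the ball [B k] makes the growth bound applicable. *)
Lemma integral_kernel_le (x : H) : separable H -> bounded_set (msupp mu) ->
  0 < mdiam mu -> upper_growth mu gamma C -> msupp mu x ->
  (\int[mu]_y (`|x - (y : H)| ^- 2)%:E <= (kernel_bound (mdiam mu))%:E)%E.
Proof.
move=> sH bS; set D := mdiam mu => D0 growth Sx.
pose B k : set (borel H) := closed_ball_ Num.norm x (D * 2^-1 ^+ k).
pose c k : R := (D * 2^-1 ^+ k.+1) ^- 2.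
have c0 k : 0 <= c k by rewrite invr_ge0 sqr_ge0.
have mB k : measurable (B k) by exact: closed_ball_borel.
pose F k (y : borel H) := (c k * \1_(B k) y)%:E.
have F0 k y : (0 <= F k y)%E by rewrite lee_fin mulr_ge0.
have mF k : measurable_fun setT (F k).
  by apply/measurable_EFinP; apply: measurable_funM.
pose N := ~` (msupp mu : set (borel H)).
have mN : measurable N by exact: (measurableC (measurable_msupp mu)).
have bound y : ((`|x - (y : H)| ^- 2)%:E <= \sum_(k <oo) F k y + infty_on N y)%E.
  have S0 : (0 <= \sum_(k <oo) F k y)%E by exact: nneseries_ge0.
  rewrite /infty_on; case: ifPn => [_|/negP].
    by rewrite addey ?leey // gt_eqF // (lt_le_trans _ S0).
  rewrite inE => /contrapT Sy; rewrite adde0.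
  (* On the diagonal the kernel is 0, as the inverse of 0 is 0. *)
  have [->|xy] := eqVneq (`|x - (y : H)|) 0.
    by rewrite expr0n /= invr0.
  have [|k /andP[kr rk]] := @dyadic_scale _ D `|x - (y : H)|.
    by rewrite lt_def xy normr_ge0 /=; exact: le_mdiam.
  apply: le_trans (nneseries_lim_ge k.+1 _) => //.
  rewrite big_nat_recr //=; apply: le_trans (leeDr _ _); last exact: sume_ge0.
  rewrite lee_fin indicE mem_set // mulr1 /c lef_pV2 ?posrE ?exprn_gt0 //; last 2 first.
    by rewrite lt_def xy normr_ge0.
    by rewrite mulr_gt0 // exprn_gt0.
  by rewrite ler_sqr ?nnegrE ?mulr_ge0 ?(ltW kr) ?exprn_ge0 ?(ltW D0).
apply: le_trans (ge0_le_integralT mu _ bound) _.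
  by move=> y; rewrite lee_fin invr_ge0 sqr_ge0.
rewrite ge0_integralD //; last 4 first.
- by move=> y _; exact: nneseries_ge0.
- exact: ge0_emeasurable_sum.
- by move=> y _; exact: infty_on_ge0.
- exact: measurable_infty_on.
have N0 : mu N = 0%E by exact: measure_setC_msupp.
rewrite integral_infty_on // adde0 integral_nneseries //.
apply: le_trans (nneseries_geometric_le _ half_powR_lt1); last first.
  by apply: divr_ge0; rewrite ?sqr_ge0 // !mulr_ge0 ?powR_ge0.
apply: lee_nneseries => [k _|k _]; first by move=> _; exact: integral_ge0.
rewrite /F; under eq_integral do rewrite EFinM.
rewrite ge0_integralZl // ?lee_fin //; last exact/measurable_EFinP.
rewrite integral_indic // setIT.
have le : (mu (B k) <= (C * (D * 2^-1 ^+ k) `^ gamma)%:E)%E.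
  apply: growth => //; rewrite mulr_gt0 ?exprn_gt0 //= ler_piMr ?(ltW D0) //.
  by rewrite exprn_ile1 // invf_le1 // ler1n.
apply: le_trans (lee_wpmul2l _ le) _; first by rewrite lee_fin.
rewrite -EFinM lee_fin powRM ?exprn_ge0 ?(ltW D0) //.
(* The factor 4^(-k) split off here cancels the growth of [c k], leaving the k-th power of 2^(2 -
   gamma). *)
have -> : (2^-1 ^+ k) `^ gamma = (2^-1 ^+ 2 * 2^-1 `^ (gamma - 2)) ^+ k :> R.
  have h0 : 0 <= 2^-1 :> R by rewrite invr_ge0.
  rewrite -(powR_mulrn k h0) -powRrM mulrC powRrM powR_mulrn ?powR_ge0 //.
  rewrite -(powR_mulrn 2 h0) -powRD ?invr_neq0 ?implybT //.
  by congr ((_ `^ _) ^+ _); ring.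
rewrite /c exprMn (exprS _ k) [(2^-1 ^+ 2 * _) ^+ k]exprMn.
rewrite [2^-1 ^+ 2 ^+ k]exprAC.
have : 2^-1 ^+ k != 0 :> R by rewrite expf_neq0 // invr_neq0.
move: (2^-1 ^+ k) (2^-1 `^ (gamma - 2) ^+ k) (D `^ gamma) => t p g t0.
by rewrite le_eqVlt; apply/orP; left; apply/eqP; field; rewrite t0 gt_eqF.
Qed.

End KernelBound.

(** * The energy *)

Section Energy.
Context {R : realType} {H : normedModType R} (dot : {dot H for idfun}).
Hypothesis dotE : forall x : H, `|x| ^+ 2 = dot x x.
Variables (mu : probability (borel H) R) (d : nat).
Hypothesis sepH : separable H.
Hypothesis bS : bounded_set (msupp mu).
Implicit Types X : d.+2.-tuple H.

Definition energy : \bar R :=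
  (\int[power_measure mu d.+2]_X ((cpol dot X) ^+ 2)%:E)%E.

Let N : set (borel H) := ~` (msupp mu : set (borel H)).

Let mN : measurable N.
Proof. exact: (measurableC (measurable_msupp mu)). Qed.

Let N0 : mu N = 0%E.
Proof. exact: measure_setC_msupp. Qed.

(** The counterpart of [infty_on] for tuples: infinite as soon as one vertex leaves the support,
    zero otherwise. *)
Definition off_msupp (X : d.+2.-tuple (borel H)) : \bar R :=
  (\sum_(i < d.+2) infty_on N (tnth X i))%E.

Lemma off_msupp_ge0 X : (0 <= off_msupp X)%E.
Proof. by apply: sume_ge0 => i _; exact: infty_on_ge0. Qed.

Lemma measurable_off_msupp : measurable_fun setT off_msupp.
Proof.
apply: emeasurable_sum => i; apply: measurableT_comp; last exact: measurable_tnth.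
exact: measurable_infty_on.
Qed.

Lemma integral_off_msupp : (\int[power_measure mu d.+2]_X off_msupp X = 0)%E.
Proof.
rewrite ge0_integral_sum // => [|i|i X _]; last exact: infty_on_ge0.
  rewrite big1 // => i _.
  rewrite (@integral_power_measure_tnth _ _ _ mu d.+2 i (infty_on N)).
  - exact: integral_infty_on.
  - exact: measurable_infty_on.
  - exact: infty_on_ge0.
by apply: measurableT_comp; [exact: measurable_infty_on|exact: measurable_tnth].
Qed.

Lemma off_msupp_dichotomy X :
  off_msupp X = +oo%E \/ forall i, msupp mu (tnth X i).
Proof.
have [/forallP Xs|/forallPn[i Xi]] := boolP [forall i, tnth X i \in msupp mu].
  by right => i; have := Xs i; rewrite inE.
left; apply/eqP; rewrite /off_msupp (bigD1 i) //=.
rewrite {1}/infty_on mem_set; last by move: Xi; rewrite notin_setE.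
rewrite addye // gt_eqF // (lt_le_trans _ (sume_ge0 _ _)) // => j _.
exact: infty_on_ge0.
Qed.

(* Only the majorant [G] is required to be measurable, not c_pol. *)
Lemma energy_le (G : d.+2.-tuple (borel H) -> \bar R) :
  measurable_fun setT G -> (forall X, 0 <= G X)%E ->
  (forall X, (forall i, msupp mu (tnth X i)) -> (((cpol dot X) ^+ 2)%:E <= G X)%E) ->
  (energy <= \int[power_measure mu d.+2]_X G X)%E.
Proof.
move=> mG G0 GX.
rewrite -[leRHS]adde0 -integral_off_msupp -ge0_integralD //; last 2 first.
- by move=> X _; exact: off_msupp_ge0.
- exact: measurable_off_msupp.
apply: ge0_le_integralT => X; first by rewrite lee_fin sqr_ge0.
have [->|SX] := off_msupp_dichotomy X.
  by rewrite addey ?leey // gt_eqF // (lt_le_trans _ (G0 X)).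
by apply: le_trans (GX X SX) _; rewrite leeDl // off_msupp_ge0.
Qed.

Lemma tdiam_le_mdiam X : (forall i, msupp mu (tnth X i)) -> tdiam X <= mdiam mu.
Proof.
move=> SX; apply: bigmax_le => [|ij _]; first exact: mdiam_ge0.
exact: le_mdiam.
Qed.

Lemma tdiam_ge0 X : 0 <= tdiam X.
Proof.
exact: le_trans (normr_ge0 _) (@edge_le_tdiam _ _ _ X ord0 (lift ord0 ord0) isT).
Qed.

(** This serves three times: for finiteness of the energy, for measures of diameter 0, and in the
    case of lines. *)
Lemma energy_le_mdiam : (energy <= (mdiam mu ^+ 2)%:E)%E.
Proof.
rewrite -[leRHS](integral_cst_probability (power_measure mu d.+2)).
apply: energy_le => // [X|X SX]; first by rewrite lee_fin sqr_ge0.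
rewrite lee_fin; apply: le_trans (cpol_sqr_le_tdiam dotE X) _.
by rewrite ler_sqr ?nnegrE ?tdiam_ge0 ?mdiam_ge0 // tdiam_le_mdiam.
Qed.

Lemma energy_ge0 : (0 <= energy)%E.
Proof. by apply: integral_ge0 => X _; rewrite lee_fin sqr_ge0. Qed.

Lemma energy_fin : energy \is a fin_num.
Proof. by rewrite ge0_fin_numE ?energy_ge0 // (le_lt_trans energy_le_mdiam) ?ltry. Qed.

Section Flat.
Variables (L : set H) (LAG : AG H d L).

Local Notation dist2 := (fun x : borel H => (dist (x : H) L ^+ 2)%:E).
Local Notation kernel := (fun x y : borel H => (`|(x : H) - (y : H)| ^- 2)%:E).

Lemma measurable_dist2 : measurable_fun setT dist2.
Proof.
have L0 := AG_nonempty LAG.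
apply/measurable_EFinP; apply: measurable_funX; exact: dist_borel L0.
Qed.

Lemma measurable_kernel :
  measurable_fun setT (fun z : borel H * borel H => kernel z.1 z.2).
Proof.
apply/measurable_EFinP.
rewrite (_ : (fun _ => _) = (@powR R ^~ (1 *- 2)) \o
    (fun z : borel H * borel H => `|(z.1 : H) - (z.2 : H)|)); last first.
  by apply/funext => z /=; rewrite powR_invn.
exact: measurableT_comp (measurable_powR _) (measurable_norm_sub sepH).
Qed.

(** The term with [dist2 x] comes out of the inner integral, leaving the kernel bound [M]. The other
    term has the same integral by Tonelli and the symmetry of the kernel. *)
Lemma integral_pair_le (M : R) : 0 <= M ->
  (forall x : H, msupp mu x -> (\int[mu]_y kernel x y <= M%:E)%E) ->
  (\int[mu]_x \int[mu]_y ((dist2 x + dist2 y) * kernel x y) <=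
   (2 * M)%:E * \int[mu]_x dist2 x)%E.
Proof.
move=> M0 kM.
have a0 x : (0 <= dist2 x)%E by rewrite lee_fin sqr_ge0.
have k0 x y : (0 <= kernel x y)%E by rewrite lee_fin invr_ge0 sqr_ge0.
have ma1 : measurable_fun setT (fun z : borel H * borel H => dist2 z.1).
  exact: measurableT_comp measurable_dist2 measurable_fst.
have ma2 : measurable_fun setT (fun z : borel H * borel H => dist2 z.2).
  exact: measurableT_comp measurable_dist2 measurable_snd.
pose g1 (z : borel H * borel H) := (dist2 z.1 * kernel z.1 z.2)%E.
pose g2 (z : borel H * borel H) := (dist2 z.2 * kernel z.1 z.2)%E.
have mg1 : measurable_fun setT g1.
  exact: emeasurable_funM ma1 measurable_kernel.
have mg2 : measurable_fun setT g2.
  exact: emeasurable_funM ma2 measurable_kernel.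
have g10 z : (0 <= g1 z)%E by exact: mule_ge0.
have g20 z : (0 <= g2 z)%E by exact: mule_ge0.
have mkx x : measurable_fun setT (fun y : borel H => kernel x y).
  exact: measurableT_comp measurable_kernel (measurable_pair1 x).
have le1 : (\int[mu]_x \int[mu]_y (dist2 x * kernel x y) <=
    M%:E * \int[mu]_x dist2 x)%E.
  apply: (@le_trans _ _ (\int[mu]_x (M%:E * dist2 x + infty_on N x))%E).
    apply: ge0_le_integralT => x; first by apply: integral_ge0 => y _; exact: mule_ge0.
    rewrite /infty_on; case: ifPn => [_|/negP].
      by rewrite addey ?leey // gt_eqF // (lt_le_trans _ (mule_ge0 _ _)).
    rewrite inE => /contrapT Sx; rewrite adde0 ge0_integralZl // muleC.
    by apply: lee_wpmul2r => //; exact: kM.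
  rewrite ge0_integralD //; last 4 first.
  - by move=> x _; apply: mule_ge0.
  - by apply: emeasurable_funM => //; exact: measurable_dist2.
  - by move=> x _; exact: infty_on_ge0.
  - exact: measurable_infty_on.
  by rewrite integral_infty_on // adde0 ge0_integralZl //; exact: measurable_dist2.
pose g12 z := (g1 z + g2 z)%E.
have mg12 : measurable_fun setT g12 by exact: emeasurable_funD.
have g120 z : (0 <= g12 z)%E by exact: adde_ge0.
have -> : (\int[mu]_x \int[mu]_y ((dist2 x + dist2 y) * kernel x y) =
    \int[mu \x mu]_z g12 z)%E.
  apply/esym; apply: etrans (fubini_tonelli1 g12 mg12 g120) _.
  apply: eq_integral => x _; apply: eq_integral => y _ /=.
  by rewrite /g12 /g1 /g2 /= ge0_muleDl.
rewrite /g12 ge0_integralD // (fubini_tonelli1 g1) // (fubini_tonelli2 g2) //.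
rewrite mulrDl mul1r EFinD ge0_muleDl ?lee_fin //.
apply: leeD; first exact: le1.
apply: le_trans le1; rewrite le_eqVlt; apply/orP; left; apply/eqP.
apply: eq_integral => x _; apply: eq_integral => y _ /=.
by rewrite /g2 /= distrC.
Qed.

(** The constant collects [2 * mdiam mu ^+ 2] from the pointwise bound on the curvature,
    [(d + 1) * (d + 2)] ordered pairs of vertices, and [2 * M] for each pair. *)
Lemma energy_le_dist (M : R) : 0 <= M ->
  (forall x : H, msupp mu x -> (\int[mu]_y kernel x y <= M%:E)%E) ->
  (energy <= (4 * d.+1%:R * d.+2%:R * mdiam mu ^+ 2 * M)%:E *
     \int[mu]_x dist2 x)%E.
Proof.
move=> M0 kM; pose c := 2 * mdiam mu ^+ 2.
have c0 : 0 <= c by rewrite mulr_ge0 ?sqr_ge0.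
pose g (z : borel H * borel H) := (c%:E * ((dist2 z.1 + dist2 z.2) * kernel z.1 z.2))%E.
have pos x y : (0 <= (dist2 x + dist2 y) * kernel x y)%E.
  apply: mule_ge0; last by rewrite lee_fin invr_ge0 sqr_ge0.
  by apply: adde_ge0; rewrite lee_fin sqr_ge0.
have g0 z : (0 <= g z)%E by apply: mule_ge0; [rewrite lee_fin|exact: pos].
have mg' : measurable_fun setT (fun z : borel H * borel H =>
    ((dist2 z.1 + dist2 z.2) * kernel z.1 z.2)%E).
  apply: emeasurable_funM; last exact: measurable_kernel.
  by apply: emeasurable_funD; apply: (measurableT_comp measurable_dist2).
have mg : measurable_fun setT g.
  exact: emeasurable_funM (measurable_cst _) mg'.
pose G (X : d.+2.-tuple (borel H)) :=
  (\sum_(i < d.+2) \sum_(k < d.+2) if k != i then g (tnth X k, tnth X i) else 0)%E.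
have mpair i k : measurable_fun setT (fun X : d.+2.-tuple (borel H) =>
    if k != i then g (tnth X k, tnth X i) else 0%E).
  case: (k != i); last exact: measurable_cst.
  apply: measurableT_comp mg _.
  by apply: measurable_fun_pair; exact: measurable_tnth.
have pair0 i k X : (0 <= if k != i then g (tnth X k, tnth X i) else 0)%E.
  by case: ifP.
have mG : measurable_fun setT G.
  by apply: emeasurable_sum => i; apply: emeasurable_sum => k.
have G0 X : (0 <= G X)%E by apply: sume_ge0 => i _; apply: sume_ge0 => k _.
apply: (le_trans (energy_le mG G0 _)) => [X SX|].
  apply: (@le_trans _ _ (2 * tdiam X ^+ 2 * \sum_i \sum_(k | k != i)
    (dist (tnth X k) L ^+ 2 + dist (tnth X i) L ^+ 2) / edge X k i ^+ 2)%:E).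
    by rewrite lee_fin; exact: cpol_sqr_le_dist.
  apply: (@le_trans _ _ (c * \sum_i \sum_(k | k != i)
    (dist (tnth X k) L ^+ 2 + dist (tnth X i) L ^+ 2) / edge X k i ^+ 2)%:E).
    rewrite lee_fin ler_wpM2r //.
      apply: sumr_ge0 => i _; apply: sumr_ge0 => k _.
      by rewrite divr_ge0 ?addr_ge0 ?sqr_ge0.
    rewrite /c ler_wpM2l // ler_sqr ?nnegrE ?tdiam_ge0 ?mdiam_ge0 //.
    exact: tdiam_le_mdiam.
  rewrite mulr_sumr -sumEFin /G; apply: lee_sum => i _.
  rewrite mulr_sumr -sumEFin big_mkcond /=; apply: lee_sum => k _.
  by case: ifP.
rewrite ge0_integral_sum // => [|i|i X _]; last 2 first.
- by apply: emeasurable_sum.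
- by apply: sume_ge0.
have pairE i k : (\int[power_measure mu d.+2]_X
    (if k != i then g (tnth X k, tnth X i) else 0) <=
    if k != i then (c * (2 * M))%:E * \int[mu]_x dist2 x else 0)%E.
  case: ifP => [ki|_]; last by rewrite integral0.
  rewrite (@integral_power_measure_tnth2 _ _ _ mu d.+2 k i g) //.
  rewrite EFinM -muleA.
  apply: le_trans (lee_wpmul2l _ (integral_pair_le M0 kM)); last by rewrite lee_fin.
  rewrite -ge0_integralZl ?lee_fin //; last 2 first.
  - by apply: (measurable_fun_fubini_tonelli_F (fun z : borel H * borel H =>
      (dist2 z.1 + dist2 z.2) * kernel z.1 z.2)%E) => // z; exact: pos.
  - by move=> x _; apply: integral_ge0 => y _; exact: pos.
  rewrite le_eqVlt; apply/orP; left; apply/eqP; apply: eq_integral => x _.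
  rewrite -ge0_integralZl ?lee_fin //.
  exact: measurableT_comp mg' (measurable_pair1 x).
apply: (@le_trans _ _ (\sum_(i < d.+2) \sum_(k < d.+2)
    if k != i then (c * (2 * M))%:E * \int[mu]_x dist2 x else 0)%E).
  apply: lee_sum => i _; rewrite ge0_integral_sum //.
  by apply: lee_sum => k _; exact: pairE.
have sum_cst (P : pred 'I_d.+2) V :
    (\sum_(k | P k) V = (#|P|%:R)%:E * V :> \bar R)%E.
  rewrite (eq_bigr (fun=> 1%:E * V)%E) => [|k _]; last by rewrite mul1e.
  by rewrite -ge0_sume_distrl ?sumEFin ?sumr_const // => k _; rewrite lee_fin.
rewrite (eq_bigr (fun=> (d.+1%:R)%:E * ((c * (2 * M))%:E * \int[mu]_x dist2 x))%E).
  2: by move=> i _; rewrite -big_mkcond sum_cst (cardC1 i) card_ord.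
rewrite sum_cst card_ord !muleA -!EFinM.
rewrite le_eqVlt; apply/orP; left; apply/eqP; congr (_%:E * _)%E.
by rewrite /c /=; ring.
Qed.

End Flat.
End Energy.

(** * Approximation by lines *)

Section LineApproximation.
Context {R : realType} {H : normedModType R} (mu : probability (borel H) R).
Variables (gamma C : R).

(* Chosen so that a tube of radius [tube_radius D] and length comparable to [D]
   has measure at most 1/2. *)
Definition tube_radius (D : R) : R :=
  Num.min (D / 5) ((22 * C * D * 5 `^ gamma)^-1 `^ (gamma - 1)^-1).

Hypothesis gamma_gt1 : 1 < gamma.
Hypothesis C_gt0 : 0 < C.

Lemma tube_radius_gt0 (D : R) : 0 < D -> 0 < tube_radius D.
Proof.
move=> D0; rewrite lt_min divr_gt0 //= powR_gt0 // invr_gt0.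
by rewrite !mulr_gt0 // powR_gt0.
Qed.

(** The left side is a number of pieces times a bound on the measure of each. With t the radius,
    t^gamma = t * t^(gamma - 1) cancels the division by t, and the second entry of the minimum
    controls t^(gamma - 1); the 22 there is 2 times 11. *)
Lemma tube_radius_bound (D : R) : 0 < D ->
  11 * D / tube_radius D * (C * (5 * tube_radius D) `^ gamma) <= 2^-1.
Proof.
move=> D0; have t0 := tube_radius_gt0 D0; set t := tube_radius D in t0 *.
have A0 : 0 < 22 * C * D * 5 `^ gamma by rewrite !mulr_gt0 // powR_gt0.
have tle : t `^ (gamma - 1) <= (22 * C * D * 5 `^ gamma)^-1.
  have g10 : gamma - 1 != 0 by rewrite subr_eq0 gt_eqF.
  set k := (22 * _ * _ * _)^-1; have k0 : 0 <= k by rewrite invr_ge0 ltW.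
  rewrite [leRHS](_ : _ = (k `^ (gamma - 1)^-1) `^ (gamma - 1)); last first.
    by rewrite -powRrM mulVf // powRr1.
  apply: ge0_ler_powR; rewrite ?nnegrE ?subr_ge0 ?(ltW gamma_gt1) ?powR_ge0 ?(ltW t0) //.
  by rewrite /t ge_min lexx orbT.
rewrite powRM ?(ltW t0) // -[t `^ gamma](_ : t * t `^ (gamma - 1) = _); last first.
  by rewrite mulr_powRB1 ?(ltW t0) // (lt_trans ltr01).
have -> : 11 * D / t * (C * (5 `^ gamma * (t * t `^ (gamma - 1)))) =
    2^-1 * (t `^ (gamma - 1) * (22 * C * D * 5 `^ gamma)).
  by field; rewrite gt_eqF.
by rewrite ler_piMr // -ler_pdivlMr // mul1r.
Qed.

(** Points of the tube are parametrised along the line and sorted into slots of parameter length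
    [t]. Points of one slot are at most [5 * t] apart, so a ball centred at a support point of the
    slot contains all of its support points. *)
Lemma tube_cover (L : set H) : separable H -> bounded_set (msupp mu) ->
  0 < mdiam mu -> upper_growth mu gamma C -> AG H 1 L ->
  exists B : set (borel H), [/\ measurable B, (mu B <= 2^-1%:E)%E &
    forall x : H, msupp mu x -> dist x L <= tube_radius (mdiam mu) -> B x].
Proof.
move=> sH bS; set D := mdiam mu => D0 growth LAG.
have t0 := tube_radius_gt0 D0; set t := tube_radius D in t0 *.
(* The entry [D / 5] of the minimum makes [5 * t] an admissible radius in the growth condition. *)
have tD : 5 * t <= D.
  by rewrite mulrC -ler_pdivlMr // /t ge_min lexx.
have [[x0 [Sx0 x0L]]|noE] := pselect (exists x, msupp mu x /\ dist x L <= t); last first.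
  exists set0; split => [||x Sx xL]; first exact: measurable0.
    by rewrite measure0 lee_fin.
  by apply: noE; exists x.
have [p [v [vfree LE]]] := LAG; set u := v ord0.
have u0 : u != 0.
  apply/eqP => u0; have := vfree (fun=> 1) _ ord0.
  by rewrite big_ord1 scale1r => /(_ u0)/eqP; rewrite oner_eq0.
pose w := `|u|^-1 *: u.
have w1 : `|w| = 1 by rewrite normrZ normfV normr_id mulVf ?normr_eq0.
(* One [t] is the distance to [L], the other the error in nearly attaining it. *)
have proj x : dist x L <= t -> exists s, `|x - (p + s *: w)| <= 2 * t.
  move=> xL; have [y Ly xy] := dist_approx x (AG_nonempty LAG) t0.
  move: Ly; rewrite LE => -[a yE]; exists (a ord0 * `|u|).
  rewrite /w scalerA mulfK ?normr_eq0 //.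
  have -> : p + a ord0 *: u = y by rewrite yE big_ord1.
  lra.
have param x x' s s' : `|x - (p + s *: w)| <= 2 * t ->
    `|x' - (p + s' *: w)| <= 2 * t ->
    `|s - s'| <= `|x - x'| + 4 * t /\ `|x - x'| <= `|s - s'| + 4 * t.
  set y := p + s *: w; set y' := p + s' *: w => h h'.
  have <- : `|y - y'| = `|s - s'|.
    by rewrite /y /y' opprD addrACA subrr add0r -scalerBl normrZ w1 mulr1.
  have := ler_distD x y y'; have := ler_distD x' x y'.
  have := ler_distD y x x'; have := ler_distD y' y x'.
  rewrite (distrC y x) (distrC y' x'); split; lra.
have [s0 x0s0] := proj x0 x0L.
(* Parameters differ from [s0] by at most [D + 4 * t <= 5 * D]. Shifted by [5 * D] and divided by
   [t] they lie between 0 and [10 * D / t]. *)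
pose n := (Num.trunc (10 * D / t)).+1.
pose slot (x : H) m := exists s, `|x - (p + s *: w)| <= 2 * t /\
  m%:R <= (s - s0 + 5 * D) / t < m.+1%:R.
have slotE x : msupp mu x -> dist x L <= t -> exists2 m, (m < n)%N & slot x m.
  move=> Sx xL; have [s xs] := proj x xL.
  have [ss0 _] := param _ _ _ _ xs x0s0.
  have xx0 : `|x - x0| <= D by exact: le_mdiam.
  have sabs : `|s - s0| <= 5 * D by lra.
  move: sabs; rewrite ler_norml => /andP[s1 s2].
  have r0 : 0 <= (s - s0 + 5 * D) / t by rewrite divr_ge0 ?(ltW t0) //; lra.
  exists (Num.trunc ((s - s0 + 5 * D) / t)).
    rewrite ltnS; apply: le_truncn.
    by rewrite ler_wpM2r ?invr_ge0 ?(ltW t0) //; lra.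
  by exists s; split => //; exact: truncn_itv.
have slot_close x x' m : slot x m -> slot x' m -> `|x - x'| <= 5 * t.
  move=> [s [xs /andP[s1 s2]]] [s' [xs' /andP[s1' s2']]].
  have [_] := param _ _ _ _ xs xs'.
  suff : `|s - s'| <= t by lra.
  move: s1 s2 s1' s2'; rewrite !ler_pdivlMr // !ltr_pdivrMr // -natr1 => *.
  by rewrite ler_norml; apply/andP; split; nra.
have /choice[B BP] m : exists Bm : set (borel H), [/\ measurable Bm,
    (mu Bm <= (C * (5 * t) `^ gamma)%:E)%E &
    forall x, msupp mu x -> slot x m -> Bm x].
  have [[y [Sy ym]]|noy] := pselect (exists x, msupp mu x /\ slot x m).
    exists (closed_ball_ Num.norm y (5 * t)); split.
    - exact: closed_ball_borel.
    - by apply: growth => //; rewrite mulr_gt0.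
    - by move=> x Sx xm; exact: slot_close ym xm.
  exists set0; split => [||x Sx xm]; first exact: measurable0.
    by rewrite measure0 lee_fin mulr_ge0 ?powR_ge0 ?(ltW C_gt0).
  by apply: noy; exists x.
exists (\big[setU/set0]_(m < n) B m); split.
- by apply: bigsetU_measurable => m _; have [] := BP m.
- apply: (le_trans (Boole_inequality mu _)) => [m _|]; first by have [] := BP m.
  apply: (@le_trans _ _ (\sum_(m < n) (C * (5 * t) `^ gamma)%:E)%E).
    by apply: lee_sum => m _; have [] := BP m.
  rewrite sumEFin lee_fin sumr_const card_ord -[leLHS]mulr_natl.
  apply: le_trans (tube_radius_bound D0).
  rewrite ler_wpM2r ?mulr_ge0 ?powR_ge0 ?(ltW C_gt0) //.
  (* As [t <= D], the extra slot is absorbed: [10 * D / t + 1 <= 11 * D / t]. *)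
  rewrite /n -natr1 -/t.
  have tr : (Num.trunc (10 * D / t))%:R <= 10 * D / t.
    by rewrite truncn_le divr_ge0 ?mulr_ge0 ?(ltW t0) ?(ltW D0).
  have : 1 <= D / t by rewrite ler_pdivlMr // mul1r; lra.
  by rewrite -!mulrA in tr *; lra.
- move=> x Sx xL; have [m mn xm] := slotE x Sx xL.
  rewrite -bigcup_mkord; exists m => //.
  by have [_ _] := BP m; apply.
Qed.

(** Chebyshev: the complement of the covering set has measure at least 1/2, and there the distance
    exceeds the tube radius at every support point. *)
Lemma integral_dist_line_ge (L : set H) : separable H -> bounded_set (msupp mu) ->
  0 < mdiam mu -> upper_growth mu gamma C -> AG H 1 L ->
  ((tube_radius (mdiam mu) ^+ 2 / 2)%:E <=
   \int[mu]_x (dist (x : H) L ^+ 2)%:E)%E.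
Proof.
move=> sH bS D0 growth LAG.
have [B [mB B2 BP]] := tube_cover sH bS D0 growth LAG.
set t := tube_radius (mdiam mu) in BP *.
have t0 : 0 < t by exact: tube_radius_gt0.
have BC2 : (2^-1%:E <= mu (~` B))%E.
  have -> : (mu (~` B) = 1 - mu B)%E by exact: probability_setC.
  have Bfin : mu B \is a fin_num by exact: fin_num_measure.
  move: B2; rewrite -(fineK Bfin) -EFinB !lee_fin; lra.
pose N : set (borel H) := ~` (msupp mu : set (borel H)).
have mN : measurable N by exact: (measurableC (measurable_msupp mu)).
have N0 : mu N = 0%E by exact: measure_setC_msupp.
have mf : measurable_fun setT (fun x : borel H => (dist (x : H) L ^+ 2)%:E).
  have L0 := AG_nonempty LAG.
  by apply/measurable_EFinP; apply: measurable_funX; exact: dist_borel L0.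
apply: (@le_trans _ _ (\int[mu]_x ((t ^+ 2)%:E * (\1_(~` B) x)%:E))%E).
  rewrite ge0_integralZl ?lee_fin ?sqr_ge0 //; last first.
    by apply/measurable_EFinP; apply: measurable_indic; exact: measurableC.
  rewrite integral_indic ?setIT; [|exact: measurableT|exact: measurableC].
  by rewrite EFinM; apply: lee_wpmul2l; rewrite ?lee_fin ?sqr_ge0.
rewrite -[leRHS]adde0 -(integral_infty_on mN N0) -ge0_integralD //; last 3 first.
- by move=> x _; rewrite lee_fin sqr_ge0.
- by move=> x _; exact: infty_on_ge0.
- exact: measurable_infty_on.
apply: ge0_le_integralT => x; first by rewrite mule_ge0 // lee_fin ?sqr_ge0.
rewrite /infty_on; case: ifPn => [_|/negP]; first by rewrite addey ?leey.
rewrite inE => /contrapT Sx; rewrite adde0 indicE.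
have [xB|xB] := boolP (x \in ~` B); last by rewrite mule0 lee_fin sqr_ge0.
rewrite mule1 lee_fin ler_sqr ?nnegrE ?(ltW t0) ?dist_ge0 //.
rewrite leNgt; apply/negP => xt; move: xB; rewrite inE; apply.
exact: BP (ltW xt).
Qed.

End LineApproximation.

(** * Constants and the infimum over flats *)

Lemma upper_growth_inf_add1 (R : realType) (H : normedModType R)
    (mu : probability (borel H) R) (gamma : R) (A : set R) :
  (forall C, A C -> 1 <= C /\ upper_growth mu gamma C) -> A !=set0 ->
  1 <= inf A + 1 /\ upper_growth mu gamma (inf A + 1).
Proof.
move=> AP A0; have infA1 : 1 <= inf A by apply: lb_le_inf => // C /AP[].
split; first by rewrite ler_wpDl ?ler01 // (le_trans ler01).
(* Some admissible constant lies below [inf A + 1], and upper growth is monotone in the constant. *)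
have [|C AC Clt] := @inf_adherent _ A 1 ltr01.
  by split => //; exists 1 => C /AP[].
move=> x t Sx tD; apply: le_trans ((AP C AC).2 x t Sx tD) _.
by rewrite lee_fin ler_wpM2r ?powR_ge0 // ltW.
Qed.

(** For diameter 0 the energy vanishes by [energy_le_mdiam]. Otherwise the bound holds for each
    flat, and finiteness of the energy allows [le_mul_e2_sqr] to pass to the infimum. *)
Lemma energy_le_e2_sqr (R : realType) (H : normedModType R)
    (dot : {dot H for idfun}) (mu : probability (borel H) R) (d : nat)
    (K1 K : R) : (forall x : H, `|x| ^+ 2 = dot x x) -> separable H ->
  bounded_set (msupp mu) -> 0 <= K1 <= K -> 0 < K ->
  (0 < mdiam mu -> forall L, AG H d L ->
    (energy dot mu d <= K1%:E * \int[mu]_x (dist (x : H) L ^+ 2)%:E)%E) ->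
  (energy dot mu d <= K%:E * e2 mu d ^+ 2)%E.
Proof.
move=> dotE sepH bS /andP[K10 K1K] K0 EL.
have Efin := energy_fin dotE d sepH bS.
rewrite -(fineK Efin); apply: le_mul_e2_sqr => // [|L LAG].
  by apply: fine_ge0; exact: energy_ge0.
rewrite (fineK Efin).
have I0 : (0 <= \int[mu]_x (dist (x : H) L ^+ 2)%:E)%E.
  by apply: integral_ge0 => x _; rewrite lee_fin sqr_ge0.
have [D0|D0] := ltP 0 (mdiam mu); last first.
  apply: le_trans (energy_le_mdiam dotE d sepH bS) _.
  have -> : mdiam mu = 0 by apply/eqP; rewrite eq_le D0 mdiam_ge0.
  by rewrite expr0n /= mule_ge0 // lee_fin ltW.
apply: le_trans (EL D0 L LAG) _.
by apply: lee_wpmul2r => //; rewrite lee_fin.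
Qed.

Theorem theorem6p1 (R : realType) (gamma : R) (gamma_gt0 : 0 < gamma) :
  exists K : nat -> R -> R -> R,
    (forall (d : nat) (D C : R), 0 < K d D C) /\
    forall (H : completeNormedModType R) (dot : {dot H for idfun}),
      (forall x : H, `|x| ^+ 2 = dot x x) ->
      separable H ->
      forall d : nat, (1 <= d)%N -> dim_ge H d ->
      forall mu : probability (borel H) R, bounded_set (msupp mu) ->
        let energy :=
          (\int[power_measure mu d.+2]_X ((cpol dot X) ^+ 2)%:E)%E in
        (upper_regular mu gamma /\ 2 < gamma ->
           (energy <= (K d (mdiam mu) (upper_reg_const mu gamma))%:E
                        * e2 mu d ^+ 2)%E) /\
        (d = 1%N /\ regular mu gamma /\ 1 < gamma ->
           (energy <= (K d (mdiam mu) (reg_const mu gamma))%:E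
                        * e2 mu d ^+ 2)%E).
Proof.
(* [C] is the infimum of the admissible constants, and growth is available with [C + 1]. *)
pose K1 (d : nat) (D C : R) :=
  4 * d.+1%:R * d.+2%:R * D ^+ 2 * kernel_bound gamma (C + 1) D.
(* The upper bound on the energy divided by the lower bound on the integral of the squared distance
   to a line. *)
pose K2 (D C : R) := D ^+ 2 / (tube_radius gamma (C + 1) D ^+ 2 / 2).
have K20 D C : 0 <= K2 D C by rewrite !divr_ge0 ?sqr_ge0.
(* One constant serves both cases. The absolute value and the 1 keep it positive for all arguments,
   even where [K1] is negative. *)
exists (fun d D C => 1 + `|K1 d D C| + K2 D C); split.
  move=> d D C; have := normr_ge0 (K1 d D C); have := K20 D C; lra.
move=> H dot dotE sepH d d_ge1 _ mu bS /=.
have Kpos C : 0 < 1 + `|K1 d (mdiam mu) C| + K2 (mdiam mu) C.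
  have := normr_ge0 (K1 d (mdiam mu) C); have := K20 (mdiam mu) C; lra.
split=> [[ureg gamma2]|[d1 [reg gamma1]]].
- have [C1 growth] := @upper_growth_inf_add1 _ _ mu gamma (upper_reg_consts mu gamma)
    (fun C => id) ureg.
  have M0 : 0 <= kernel_bound gamma (upper_reg_const mu gamma + 1) (mdiam mu).
    by apply: kernel_bound_ge0 => //; exact: le_trans ler01 C1.
  set C := upper_reg_const mu gamma in M0 *.
  have K10 : 0 <= K1 d (mdiam mu) C.
    by rewrite /K1 mulr_ge0 // mulr_ge0 ?sqr_ge0 // mulr_ge0 // mulr_ge0.
  apply: (@energy_le_e2_sqr _ _ dot mu d (K1 d (mdiam mu) C)) => // [|D0 L LAG].
    rewrite K10 /= (ger0_norm K10); have := K20 (mdiam mu) C; lra.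
  apply: energy_le_dist => // x Sx.
  apply: integral_kernel_le => //; exact: le_trans ler01 C1.
- have [C1 growth] := @upper_growth_inf_add1 _ _ mu gamma (reg_consts mu gamma)
    (fun C '(And3 C1 _ up) => conj C1 up) reg.
  set C := reg_const mu gamma.
  subst d.
  apply: (@energy_le_e2_sqr _ _ dot mu 1 (K2 (mdiam mu) C)) => // [|D0 L LAG].
    rewrite K20 /=; have := normr_ge0 (K1 1 (mdiam mu) C); lra.
  have C0 : 0 < C + 1 by exact: lt_le_trans ltr01 C1.
  apply: le_trans (energy_le_mdiam dotE 1 sepH bS) _.
  have lower := integral_dist_line_ge gamma1 C0 sepH bS D0 growth LAG.
  apply: le_trans (lee_wpmul2l _ lower); last by rewrite lee_fin.
  rewrite -EFinM lee_fin /K2 divfK //.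
  by rewrite mulf_neq0 ?invr_neq0 ?expf_neq0 // gt_eqF // tube_radius_gt0.
Qed.
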